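(* For $A\in\mathcal{PM}(n)$, $B\in\mathcal{PM}(m)$ and $i\in[n]$ define $$A\circ^{\max,\min}_i B=\begin{pmatrix}A_{11}&\mathbb{O}&\mathbb{O}\\ \mathrm{Max}_i(A,B)&B&\mathbb{O}\\ A_{21}&\mathrm{Min}_i(A,B)&A_{22}\end{pmatrix}.$$ Then $A\circ^{\max,\min}_i B$ is a poset matrix (an element of $\mathcal{PM}(n+m-1)$) for all $i\in[n]$.
   Context: A poset matrix of order $n$ is an $n\times n$ $(0,1)$-matrix $A=[a_{st}]$ that is lower triangular with all diagonal entries $1$ and transitive ($a_{st}=a_{tu}=1\Rightarrow a_{su}=1$); $\mathcal{PM}(n)$ is the set of these. The poset associated to $B=[b_{st}]\in\mathcal{PM}(m)$ is $[m]$ with $t\le s$ iff $b_{st}=1$. $A[\alpha\mid\beta]$ is the submatrix with rows $\alpha$ and columns $\beta$, $A[\alpha]=A[\alpha\mid\alpha]$. For $A\in\mathcal{PM}(n)$, $i\in[n]$: $A_{11}=A[\{1,\dots,i-1\}]$, $A_{22}=A[\{i+1,\dots,n\}]$, $A_{21}=A[\{i+1,\dots,n\}\mid\{1,\dots,i-1\}]$, $A_{(i)}=A[\{i\}\mid\{1,\dots,i-1\}]$ (row vector), $A^{(i)}=A[\{i+1,\dots,n\}\mid\{i\}]$ (column vector); empty blocks are vacuous. $\mathrm{Max}_i(A,B)$ is the $m\times(i-1)$ matrix whose $j$-th row is $A_{(i)}$ if $j$ is a maximal element of the poset associated to $B$ and zero otherwise; $\mathrm{Min}_i(A,B)$ is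 the $(n-i)\times m$ matrix whose $j$-th column is $A^{(i)}$ if $j$ is a minimal element of the poset associated to $B$ and zero otherwise. *)

(* Defs.v *)
From HB Require Import structures.
From mathcomp Require Import all_boot all_order all_algebra.

Set Implicit Arguments.
Unset Strict Implicit.
Unset Printing Implicit Defensive.

Import Order.TTheory GRing.Theory Num.Theory.
Local Open Scope ring_scope.

(* Indices are 0-based: [n] is 'I_n. In particular exactly i indices precede  *)
(* i : 'I_n and n - i.+1 indices follow it.                                   *)

Definition PM (n : nat) (A : 'M[int]_n) : Prop :=
  [/\ forall s t, A s t = 0 \/ A s t = 1,
      is_trig_mx A,
      forall s, A s s = 1 &
      forall s t u, A s t = 1 -> A t u = 1 -> A s u = 1].
Arguments PM n A : clear implicits.

(* The order relation t <= s of the poset on [m] associated to B; note the    *)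
(* reversed indices.                                                          *)
Definition poset_le (m : nat) (B : 'M[int]_m) : rel 'I_m :=
  [rel t s | B s t == 1].

Definition maximal_elt (T : finType) (le : rel T) (x : T) : bool :=
  [forall y, le x y ==> (y == x)].

Definition minimal_elt (T : finType) (le : rel T) (x : T) : bool :=
  [forall y, le y x ==> (y == x)].

(* Increasing enumerations of the indices below i and of those above i.       *)
Definition below (n : nat) (i : 'I_n) (k : 'I_i) : 'I_n :=
  widen_ord (ltnW (ltn_ord i)) k.

Definition above (n : nat) (i : 'I_n) (k : 'I_(n - i.+1)) : 'I_n :=
  cast_ord (subnKC (ltn_ord i)) (rshift i.+1 k).

Section Composition.
Variables (n m : nat) (A : 'M[int]_n) (i : 'I_n) (B : 'M[int]_m).

Definition A11 : 'M[int]_i := mxsub (@below n i) (@below n i) A.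
Definition A22 : 'M[int]_(n - i.+1) := mxsub (@above n i) (@above n i) A.
Definition A21 : 'M[int]_(n - i.+1, i) := mxsub (@above n i) (@below n i) A.
Definition Arow : 'rV[int]_i := row i (colsub (@below n i) A).
Definition Acol : 'cV[int]_(n - i.+1) := col i (rowsub (@above n i) A).

Definition Max_mx : 'M[int]_(m, i) :=
  \matrix_(j, k) if maximal_elt (poset_le B) j then Arow 0 k else 0.

Definition Min_mx : 'M[int]_(n - i.+1, m) :=
  \matrix_(k, j) if minimal_elt (poset_le B) j then Acol k 0 else 0.

Definition comp_block : 'M[int]_(i + (m + (n - i.+1))) :=
  col_mx (row_mx A11    (row_mx 0      0))
 (col_mx (row_mx Max_mx (row_mx B      0))
         (row_mx A21    (row_mx Min_mx A22))).

Lemma comp_size : (i + (m + (n - i.+1)) = n + m - 1)%N.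
Proof. by rewrite addnCA -[in RHS](subnKC (ltn_ord i)) addSn addSn subn1 /= addnC addnAC. Qed.

Definition comp_max_min : 'M[int]_(n + m - 1) :=
  castmx (comp_size, comp_size) comp_block.

End Composition.

(* Main.v *)
(* Transitivity is checked on 2 x 2 block triangular matrices, used twice.
   The off-diagonal conditions reduce to those of A, except where a relation
   of B is composed with one entering or leaving B: a minimal (maximal)
   element of B has only itself below (above) it in B, so the relation of B
   involved is then an equality. *)
Require Import Defs.
From HB Require Import structures.
From mathcomp Require Import all_boot all_order all_algebra.

Set Implicit Arguments.
Unset Strict Implicit.
Unset Printing Implicit Defensive.

Import Order.TTheory GRing.Theory Num.Theory.
Local Open Scope ring_scope.

Lemma PM_mxsub (n p : nat) (f : 'I_p -> 'I_n) (A : 'M[int]_n) :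
  {homo f : s t / (s < t)%N} -> PM n A -> PM p (mxsub f f A).
Proof.
move=> f_mono [A01 /is_trig_mxP Atrig A1 Atr]; split=> [s t||s|s t u].
- by rewrite mxE.
- by apply/is_trig_mxP=> s t lt_st; rewrite mxE Atrig ?f_mono.
- by rewrite mxE.
- by rewrite !mxE; apply: Atr.
Qed.

Lemma PM_castmx (p q : nat) (eq_pq : p = q) (A : 'M[int]_p) :
  PM p A -> PM q (castmx (eq_pq, eq_pq) A).
Proof. by case: q / eq_pq; rewrite castmx_id. Qed.

(** A chain [s], [t], [u] with a step into the upper right zero block would need 0 = 1. The only
    mixed chains left go from lower to upper indices, by [Q] then [P] or by [R] then [Q]; these are
    the last two hypotheses. *)
Lemma PM_block_mx (p q : nat) (P : 'M[int]_p) (Q : 'M[int]_(q, p))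
    (R : 'M[int]_q) :
    PM p P -> PM q R -> (forall s t, Q s t = 0 \/ Q s t = 1) ->
    (forall s t u, Q s t = 1 -> P t u = 1 -> Q s u = 1) ->
    (forall s t u, R s t = 1 -> Q t u = 1 -> Q s u = 1) ->
  PM (p + q) (block_mx P 0 Q R).
Proof.
move=> [P01 Ptrig P1 Ptr] [R01 Rtrig R1 Rtr] Q01 QP RQ.
split=> [s t||s|s t u].
- case: (split_ordP s) => s' ->; case: (split_ordP t) => t' ->;
    by rewrite ?(block_mxEul, block_mxEur, block_mxEdl, block_mxEdr) ?mxE //;
       left.
- by rewrite is_trig_block_mx // eqxx Ptrig.
- by case: (split_ordP s) => s' ->; rewrite ?(block_mxEul, block_mxEdr).
- case: (split_ordP s) => s' ->; case: (split_ordP t) => t' ->;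
    case: (split_ordP u) => u' ->;
    rewrite ?(block_mxEul, block_mxEur, block_mxEdl, block_mxEdr)
            ?[(0 : 'M_(_, _)) _ _]mxE //.
  + exact: Ptr.
  + exact: QP.
  + exact: RQ.
  + exact: Rtr.
Qed.

(** Splitting off [A11] first leaves a lower right block that is itself block triangular, so
    [PM_block_mx] can be applied to it again. *)
Lemma comp_blockE (n m : nat) (A : 'M[int]_n) (i : 'I_n) (B : 'M[int]_m) :
  comp_block A i B =
  block_mx (A11 A i) 0 (col_mx (Max_mx A i B) (A21 A i))
           (block_mx B 0 (Min_mx A i B) (A22 A i)).
Proof. by rewrite /comp_block row_mx0 /block_mx -block_mxEh. Qed.

Lemma Max_mxP (n m : nat) (A : 'M[int]_n) (i : 'I_n) (B : 'M[int]_m) j k :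
  Max_mx A i B j k = 1 <-> maximal_elt (poset_le B) j /\ A i (below k) = 1.
Proof. by rewrite !mxE; case: ifP => // _; split=> // -[]. Qed.

Lemma Min_mxP (n m : nat) (A : 'M[int]_n) (i : 'I_n) (B : 'M[int]_m) k j :
  Min_mx A i B k j = 1 <-> minimal_elt (poset_le B) j /\ A (above k) i = 1.
Proof. by rewrite !mxE; case: ifP => // _; split=> // -[]. Qed.

Lemma maximal_poset_le (m : nat) (B : 'M[int]_m) s t :
  maximal_elt (poset_le B) t -> B s t = 1 -> s = t.
Proof. by move=> /forallP/(_ s)/implyP h /eqP/h/eqP. Qed.

Lemma minimal_poset_le (m : nat) (B : 'M[int]_m) s t :
  minimal_elt (poset_le B) s -> B s t = 1 -> t = s.
Proof. by move=> /forallP/(_ t)/implyP h /eqP/h/eqP. Qed.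

Theorem theorem5 (n m : nat) (A : 'M[int]_n) (B : 'M[int]_m)
    (hA : PM n A) (hB : PM m B) (i : 'I_n) :
  PM (n + m - 1) (comp_max_min A i B).
Proof.
apply: PM_castmx; rewrite comp_blockE.
have [A01 _ _ Atr] := hA.
have PM11 : PM i (A11 A i) by exact: PM_mxsub.
have PM22 : PM (n - i.+1) (A22 A i).
  by apply: PM_mxsub => // s t /=; rewrite ltn_add2l.
apply: PM_block_mx => //.
- apply: PM_block_mx => // [s t|s t u|s t u].
  + by rewrite !mxE; case: ifP => _; [exact: A01 | left].
  + move=> /[dup] st1 /Min_mxP[t_min _] tu1.
    by rewrite (minimal_poset_le t_min tu1).
  (* Minimality concerns only the column [u], which is kept; the rest is transitivity of [A] along
     [above s], [above t], [i]. *)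
  + rewrite mxE => st1 /Min_mxP[u_min ti1].
    by apply/Min_mxP; split=> //; apply: Atr ti1.
- move=> s t; case: (split_ordP s) => s' ->;
    rewrite ?(col_mxEu, col_mxEd) !mxE; last exact: A01.
  by case: ifP => _; [exact: A01 | left].
- move=> s t u; case: (split_ordP s) => s' ->; rewrite ?(col_mxEu, col_mxEd).
  (* Dually, maximality concerns only the row [s], which is kept. *)
  + move=> /Max_mxP[s_max it1]; rewrite mxE => tu1.
    by apply/Max_mxP; split=> //; apply: Atr tu1.
  + by rewrite !mxE; apply: Atr.
- move=> s t u; case: (split_ordP s) => s' ->; case: (split_ordP t) => t' ->;
    rewrite ?(block_mxEul, block_mxEur, block_mxEdl, block_mxEdr)
            ?(col_mxEu, col_mxEd).
  + move=> st1 /[dup] tu1 /Max_mxP[t_max _].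
    by rewrite (maximal_poset_le t_max st1).
  + by rewrite mxE.
  (* A chain passing through the element [t] of [B]: in [A] it becomes a chain through [i], so the
     [A21] entry is 1. *)
  + by move=> /Min_mxP[_ si1] /Max_mxP[_ iu1]; rewrite mxE; apply: Atr iu1.
  + by rewrite !mxE; apply: Atr.
Qed.
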